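(* Let $M$ be a (nonempty) compact manifold of dimension at least $2$. If there exists a homeomorphism $h\colon M\to M$ that is minimal, then there exists a continuous map $g\colon M\to M$ that is minimal and noninvertible (i.e. $g$ is not a homeomorphism).
   Context: Manifolds are topological manifolds; a compact manifold is regarded as a compact metric space. A continuous self map $f\colon X\to X$ of a compact metric space $X$ is called minimal if for every point $x\in X$ the forward orbit $\{f^n(x): n\in\mathbb{N}\}$ is dense in $X$. A continuous map $g\colon M\to M$ is noninvertible if it is not a homeomorphism of $M$ (a minimal map of a compact space being surjective, this means that $g$ is not injective). *)

(* Defs.v *)
From HB Require Import structures.
From mathcomp Require Import all_boot all_order all_algebra.
From mathcomp Require Import all_classical all_reals all_analysis.

Set Implicit Arguments.
Unset Strict Implicit.
Unset Printing Implicit Defensive.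

Import Order.TTheory GRing.Theory Num.Theory.
Import numFieldNormedType.Exports.

Local Open Scope classical_set_scope.
Local Open Scope ring_scope.

Definition homeomorphism (X Y : topologicalType) (f : X -> Y) : Prop :=
  continuous f /\
  exists g : Y -> X, [/\ continuous g, cancel f g & cancel g f].

(* [phi] and [psi] are total functions; only their restrictions to [U] and [V]
   matter, and these are mutually inverse homeomorphisms. *)
Definition homeomorphism_between (X Y : topologicalType)
    (U : set X) (V : set Y) (phi : X -> Y) (psi : Y -> X) : Prop :=
  [/\ set_fun U V phi, set_fun V U psi,
      (forall x, U x -> psi (phi x) = x),
      (forall y, V y -> phi (psi y) = y) &
      {within U, continuous phi} /\ {within V, continuous psi}].

Definition locally_euclidean (R : realType) (n : nat) (M : topologicalType) :
    Prop :=
  forall x : M, exists (U : set M) (V : set 'rV[R]_n)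
    (phi : M -> 'rV[R]_n) (psi : 'rV[R]_n -> M),
    [/\ open U, U x, open V & homeomorphism_between U V phi psi].

(* Manifolds have no boundary and need not be connected. *)
Definition is_manifold (R : realType) (n : nat) (M : topologicalType) : Prop :=
  [/\ hausdorff_space M, @second_countable M & locally_euclidean R n M].

Definition minimal_map (X : topologicalType) (f : X -> X) : Prop :=
  forall x : X, dense (range (fun n : nat => iter n f x)).

(* Main.v *)
(** Let [x0] be a point of [M] with a chart in which [x0] is the origin, and let
    [F = y_0 / |y|] near [x0], where [y] is the chart and [|y|] its sup norm.
    Replacing every point [x] by the points [(x, (t_k)_k)] with
    [t_k = F (h^k x)], or [t_k] arbitrary in [[-1, 1]] when [h^k x = x0], blows
    up every point of the backward orbit of [x0] to an arc (the dimension has to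
    be at least 2 for [F] to take all values in [[-1, 1]] arbitrarily close to
    [x0]).  On the resulting compact space [X] the map
    [(x, (t_k)_k) |-> (h x, (t_(k+1))_k)] is continuous and minimal, but it
    collapses the arc over [x0] to a point.

    It remains to see that [X] is homeomorphic to [M].  Blowing up a single
    point changes a manifold by a homeomorphism arbitrarily close to the
    projection: in a box of radius [r] one replaces [(y_0, t)] by
    [(y_0 + r t) / 2].  Doing this for one point of the orbit at a time, with
    rapidly decreasing errors, gives a sequence of maps [X -> M] that separate
    more and more points, and its limit is a continuous bijection. *)

Require Import Defs.
From HB Require Import structures.
From mathcomp Require Import all_boot all_order all_algebra.
From mathcomp Require Import all_classical all_reals all_analysis.
From mathcomp Require Import ring lra.

Set Implicit Arguments.
Unset Strict Implicit.
Unset Printing Implicit Defensive.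

Import Order.TTheory GRing.Theory Num.Theory.
Import numFieldNormedType.Exports.

Local Open Scope classical_set_scope.
Local Open Scope ring_scope.

(** * Compactness, closedness and continuity tools *)

Section Topology.

(* [f^-1 C] is the projection along the compact [Y] of the closed set
   [{(x, y) | G x y /\ C (phi y)}]. *)
Lemma continuous_closed_rel (X Y Z : topologicalType) (G : X -> Y -> Prop)
    (phi : Y -> Z) (f : X -> Z) :
  compact [set: Y] -> closed [set w : X * Y | G w.1 w.2] -> continuous phi ->
  (forall x, exists y, G x y) -> (forall x y, G x y -> phi y = f x) ->
  continuous f.
Proof.
move=> cY cG cphi totG Gf x W; rewrite nbhsE /= => -[W' [oW' W'fx] W'W].
apply: (@filterS _ _ _ (f @^-1` W')); first by move=> y; exact: W'W.
have /compact_near_coveringP cov := cY.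
pose P x' y := G x' y -> W' (phi y).
suff /(cov X (nbhs x) P _) : forall y, [set: Y] y ->
    \forall y' \near y & x' \near nbhs x, P x' y'.
  apply: filterS => x' Vx; have [y Gy] := totG x'.
  by rewrite /= -(Gf _ _ Gy); exact: Vx.
move=> y _; have [Wy|nWy] := pselect (W' (phi y)).
  have Wy' : nbhs y (phi @^-1` W') by apply: cphi; exact: open_nbhs_nbhs.
  exists (phi @^-1` W', setT) => /=; first by split => //; exact: filterT.
  by move=> [y1 x1] [W1 _] _.
have nG : ~ G x y by move=> /Gf E; apply: nWy; rewrite E.
have oG : open (~` [set w : X * Y | G w.1 w.2]) by rewrite openC.
have [[A B] /= [Ax By] AB] : nbhs (x, y) (~` [set w : X * Y | G w.1 w.2]).
  exact: open_nbhs_nbhs.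
exists (B, A) => //= -[y' x'] /= [By' Ax'] Gx'.
by have := AB (x', y') (conj Ax' By').
Qed.

Lemma closed_eq_continuous (X Y : topologicalType) (f g : X -> Y) :
  hausdorff_space Y -> continuous f -> continuous g ->
  closed [set x | f x = g x].
Proof.
move=> hY cf cg x cx; apply: hY => A B Afx Bgx.
have fA : nbhs x (f @^-1` A) by exact: cf.
have gB : nbhs x (g @^-1` B) by exact: cg.
have [y [/= E [Ay By]]] := cx _ (filterI fA gB).
by exists (f y); split => //; rewrite E.
Qed.

Lemma closed_le_continuous (R : realType) (X : topologicalType) (f g : X -> R) :
  continuous f -> continuous g -> closed [set x | f x <= g x].
Proof.
move=> cf cg.
rewrite [X in closed X](_ : _ = (fun x => g x - f x) @^-1` [set t | 0 <= t]).
  apply: preimage_closed; last exact: closed_ge.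
  by move=> x _; apply: continuousB; [exact: cg|exact: cf].
by apply/seteqP; split => x /=; rewrite subr_ge0.
Qed.

Lemma compact_pos_lbound (R : realType) (X : topologicalType) (A : set X)
    (f : X -> R) :
  compact A -> continuous f -> (forall x, A x -> 0 < f x) ->
  exists2 d, 0 < d & forall x, A x -> d < f x.
Proof.
move=> cA cf pf; have [[a Aa]|/set0P] := pselect (A !=set0); last first.
  by move=> /negP/negPn/eqP ->; exists 1.
have [||c /set_mem Ac cmin] := @compact_EVT_min _ _ f A _ cA.
- by exists a.
- exact: continuous_subspaceT.
exists (f c / 2); first by rewrite divr_gt0// pf.
move=> x Ax; apply: lt_le_trans (cmin x (mem_set Ax)).
by rewrite ltr_pdivrMr// mulr_natr mulr2n ltrDl pf.
Qed.

(** Off [O] the function [f] is positive, hence bounded below there by compactness. Applied to [nu],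
    this puts a small box inside any given neighbourhood of the centre, the zero of [nu]. *)
Lemma compact_small (R : realType) (X : topologicalType) (O : set X)
    (f : X -> R) :
  compact [set: X] -> continuous f -> open O -> (forall x, f x <= 0 -> O x) ->
  exists2 r, 0 < r & forall x, f x <= r -> O x.
Proof.
move=> cX cf oO fO.
have [||d d0 dP] := @compact_pos_lbound R X (~` O) f _ cf.
- by apply: subclosed_compact cX _ => //; exact: open_closedC.
- by move=> x nOx; rewrite ltNge; apply: contra_notN nOx; exact: fO.
- exists d => // x xd; apply: contrapT => /dP.
  by rewrite ltNge xd.
Qed.

Lemma mdist_continuous (R : realType) (M : metricType R) (X : topologicalType)
    (f g : X -> M) :
  continuous f -> continuous g -> continuous (fun x => mdist (f x) (g x)).
Proof.
move=> cf cg x; apply/cvgrPdist_lt => e e_gt0.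
have e2_gt0 : 0 < e / 2 by rewrite divr_gt0.
have near_f : \forall y \near x, mdist (f x) (f y) < e / 2.
  by apply: metricType_numDomainType.cvgr_dist_lt e2_gt0; exact: cf.
have near_g : \forall y \near x, mdist (g x) (g y) < e / 2.
  by apply: metricType_numDomainType.cvgr_dist_lt e2_gt0; exact: cg.
near=> y; have fy : mdist (f x) (f y) < e / 2 by near: y.
have gy : mdist (g x) (g y) < e / 2 by near: y.
have := metric_triangle (f x) (f y) (g x).
have := metric_triangle (f y) (g y) (g x).
have := metric_triangle (f y) (f x) (g y).
have := metric_triangle (f x) (g x) (g y).
rewrite (metric_sym (g y) (g x)) (metric_sym (f y) (f x)) => *.
by rewrite ltr_norml; apply/andP; split; lra.
Unshelve. all: by end_near. Qed.

Lemma continuousT_comp (X Y Z : topologicalType) (f : X -> Y) (g : Y -> Z) :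
  continuous f -> continuous g -> continuous (g \o f).
Proof. by move=> cf cg x; apply: continuous_comp; [exact: cf|exact: cg]. Qed.

Lemma continuous_comp_fst (X X' Y : topologicalType) (f : X -> Y) :
  continuous f -> continuous (fun v : X * X' => f v.1).
Proof.
by move=> cf; apply: (@continuousT_comp _ _ _ fst f) => // v; exact: cvg_fst.
Qed.

Lemma continuous_comp_snd (X X' Y : topologicalType) (f : X' -> Y) :
  continuous f -> continuous (fun v : X * X' => f v.2).
Proof.
by move=> cf; apply: (@continuousT_comp _ _ _ snd f) => // v; exact: cvg_snd.
Qed.

Lemma continuous_add (R : realType) (X : topologicalType) (f g : X -> R) :
  continuous f -> continuous g -> continuous (fun x => f x + g x).
Proof. by move=> cf cg x; exact: (continuousD (cf x) (cg x)). Qed.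

Lemma open_lt_continuous (R : realType) (X : topologicalType) (f : X -> R) r :
  continuous f -> open [set x | f x < r].
Proof.
move=> cf; rewrite [X in open X](_ : _ = ~` [set x | r <= f x]).
  by rewrite openC; apply: closed_le_continuous => // x; exact: cvg_cst.
by apply/seteqP; split=> x /=; rewrite ltNge => /negP.
Qed.

Lemma iter_continuous (X : topologicalType) (f : X -> X) k :
  continuous f -> continuous (iter k f).
Proof.
move=> cf; elim: k => [|k IH] x; first exact: cvg_id.
by apply: (@continuous_comp _ _ _ (iter k f) f); [exact: IH|exact: cf].
Qed.

End Topology.

(** * The slope relation on a line of the box, with [m] in the role of [|q|] *)

Section Slope.
Context {R : realType}.
Implicit Types m p t r c : R.

(** The equation describes the graph of [p / max(|p|, m)], a nondecreasing function of [p], with all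
    of [[-1, 1]] as slopes at [p = 0] when [m <= 0]. *)
Lemma slope_mono m p1 p2 t1 t2 :
  `|t1| <= 1 -> `|t2| <= 1 ->
  t1 * Num.max `|p1| m = p1 -> t2 * Num.max `|p2| m = p2 ->
  p1 < p2 -> t1 <= t2.
Proof.
(* The symmetry [(p, t) |-> (-p, -t)] exchanges the roles of the two points. *)
wlog t2_ge0 : p1 p2 t1 t2 / 0 <= t2 => [wl|].
  have [t2_ge0|t2_lt0] := leP 0 t2; first exact: wl.
  move=> t1b t2b E1 E2 lt12; have [t1_gt0|t1_le0] := ltP 0 t1.
    suff : p1 >= 0 /\ p2 <= 0 by move=> [? ?]; lra.
    split; [rewrite -E1|rewrite -E2].
      by rewrite mulr_ge0 ?(ltW t1_gt0)// le_max normr_ge0.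
    by rewrite mulr_le0_ge0 ?(ltW t2_lt0)// le_max normr_ge0.
  rewrite -lerN2; apply: (wl (- p2) (- p1)); rewrite ?normrN ?mulNr ?E1 ?E2//.
    by rewrite oppr_ge0.
  by rewrite ltrN2.
move=> t1b t2b E1 E2 lt12; rewrite leNgt; apply/negP => lt21.
have t1_le1 := le_trans (ler_norm t1) t1b.
have N1 : m <= Num.max `|p1| m by rewrite le_max lexx orbT.
have p1_ge0 : 0 <= p1.
  rewrite -E1 mulr_ge0// ?(ltW (le_lt_trans t2_ge0 lt21))//.
  by rewrite le_max normr_ge0.
have p2_gt0 := le_lt_trans p1_ge0 lt12.
(* If [|p2| <= m], then [p2 = t2 * m <= t1 * m <= p1]; otherwise [t2 = 1 < t1]. Both are
   impossible. *)
move: E2; have [le E2|_] := leP `|p2| m.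
  have m_ge0 := le_trans (normr_ge0 _) le.
  have t1_ge0 := ltW (le_lt_trans t2_ge0 lt21).
  have := ler_wpM2l t1_ge0 N1; have := ler_wpM2r m_ge0 (ltW lt21).
  by rewrite E1 E2; lra.
rewrite gtr0_norm// => E2; have : (1 - t2) * p2 = 0 by rewrite mulrBl E2; ring.
by move/eqP; rewrite mulf_eq0 => /orP[] /eqP; lra.
Qed.

(** By monotonicity [p + r * t] is strictly increasing in [p] along the graph. *)
Lemma slope_inj m p1 p2 t1 t2 r :
  0 < r -> `|t1| <= 1 -> `|t2| <= 1 ->
  t1 * Num.max `|p1| m = p1 -> t2 * Num.max `|p2| m = p2 ->
  p1 + r * t1 = p2 + r * t2 -> p1 = p2 /\ t1 = t2.
Proof.
move=> r_gt0 t1b t2b E1 E2 E.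
suff Ep : p1 = p2.
  by split => //; move: E; rewrite Ep => /addrI/(mulfI (lt0r_neq0 r_gt0)).
have [lt|lt|//] := ltgtP p1 p2.
  by have := slope_mono t1b t2b E1 E2 lt; nra.
by have := slope_mono t2b t1b E2 E1 lt; nra.
Qed.

Lemma slope_surj m c r :
  0 < r -> 0 <= m <= r -> `|c| <= r ->
  exists p t, [/\ `|t| <= 1, `|p| <= r, t * Num.max `|p| m = p &
    p + r * t = 2 * c].
Proof.
move=> r_gt0 /andP[m_ge0 mr].
wlog c_ge0 : c / 0 <= c => [wl|].
  have [c_ge0|c_lt0] := leP 0 c; first exact: wl.
  move=> cr; have [||p [t [tb pb E1 E2]]] := wl (- c).
  - by rewrite oppr_ge0 ltW.
  - by rewrite normrN.
  exists (- p), (- t); rewrite !normrN; split=> //; first by rewrite mulNr E1.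
  by lra.
(* The graph bends at [p = m], [t = 1], where [p + r * t = m + r]: below the bend [p = t * m], above
   it [t = 1]. *)
rewrite ger0_norm// => cr; have [le|lt] := leP (2 * c) (m + r).
  have mr_gt0 : 0 < m + r by rewrite ltr_wpDl.
  pose t := 2 * c / (m + r).
  have t_ge0 : 0 <= t by rewrite divr_ge0 ?mulr_ge0 ?(ltW mr_gt0).
  have t_le1 : t <= 1 by rewrite ler_pdivrMr// mul1r.
  have Et : t * (m + r) = 2 * c by rewrite divfK// lt0r_neq0.
  have tm_ge0 : 0 <= t * m by rewrite mulr_ge0.
  exists (t * m), t; rewrite (ger0_norm t_ge0) (ger0_norm tm_ge0).
  split => //; [nra| |lra].
  by rewrite max_r//; nra.
exists (2 * c - r), 1; rewrite normr1 ger0_norm; last lra.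
by split => //; [lra|rewrite max_l; lra|lra].
Qed.

End Slope.

(** * Blowing up the backward orbit *)

Section BlowUp.
Context {R : realType} {M : metricType R} {X : topologicalType}
  {Q : normedModType R}.
(* [p], [q] and [nu] stand for the first coordinate, the remaining coordinates
   and the sup norm of a chart at the point to be blown up; [px] and [T k] are
   the coordinates [x] and [t_k] of the blown-up space [X]. *)
Variables (h : M -> M) (nu p : M -> R) (q : M -> Q) (r0 : R).
Variables (px : X -> M) (T : nat -> X -> R).

Hypotheses (cX : compact [set: X]) (cM : compact [set: M]).
Hypotheses (h_cont : continuous h) (h_bij : bijective h).
Hypotheses (nu_cont : continuous nu) (p_cont : continuous p)
  (q_cont : continuous q) (px_cont : continuous px)
  (T_cont : forall k, continuous (T k)).
Hypothesis r0_gt0 : 0 < r0.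
Hypothesis nuE : forall x, nu x <= r0 -> nu x = Num.max `|p x| `|q x|.
Hypothesis box_surj : forall a b, `|a| <= r0 -> `|b| <= r0 ->
  exists x, [/\ nu x <= r0, p x = a & q x = b].
Hypothesis box_inj : forall x y, nu x <= r0 -> nu y <= r0 ->
  p x = p y -> q x = q y -> x = y.
Hypothesis p_le_nu : forall x, `|p x| <= nu x.
Hypothesis nu_orbit : forall j k x, (j < k)%N ->
  nu (iter k h x) = 0 -> nu (iter j h x) != 0.
Hypothesis T_le1 : forall k z, `|T k z| <= 1.
Hypothesis TE : forall k z, T k z * nu (iter k h (px z)) = p (iter k h (px z)).
Hypothesis fiber_surj : forall k x t, `|t| <= 1 ->
  t * nu (iter k h x) = p (iter k h x) -> exists2 z, px z = x & T k z = t.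

Local Notation u k z := (iter k h (px z)).

(* [X / sim k] is [M] with the first [k] points of the backward orbit blown up;
   [blow_down k Phi] makes [Phi] induce a homeomorphism from it to [M]. *)
Definition sim k (z w : X) :=
  px z = px w /\ forall j, (j < k)%N -> T j z = T j w.

Definition blow_down k (Phi : X -> M) :=
  [/\ continuous Phi, (forall y, exists z, Phi z = y) &
    forall z w, Phi z = Phi w <-> sim k z w].

Lemma nu_ge0 x : 0 <= nu x.
Proof. exact: le_trans (normr_ge0 _) (p_le_nu x). Qed.

(** [TE] forces the slope to be [p / nu], so a slope can vary within a fibre of [px] only where [nu]
    vanishes. *)
Lemma T_inj k z w : px z = px w -> nu (u k z) != 0 -> T k z = T k w.
Proof.
move=> E nz; have := TE k w; rewrite -E => Ew.
by apply: (mulIf nz); rewrite Ew TE.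
Qed.

Lemma iter_bij k : bijective (iter k h).
Proof.
elim: k => [|k IH]; first by exists id.
exact: (@bij_comp _ _ _ h (iter k h)).
Qed.

Lemma iter_surj k y : exists x, iter k h x = y.
Proof. by have [g _ gK] := iter_bij k; exists (g y); rewrite gK. Qed.

Lemma iter_inj k : injective (iter k h).
Proof. exact: bij_inj (iter_bij k). Qed.

Lemma px_surj x : exists z, px z = x.
Proof.
have [||z Ez _] := @fiber_surj 0%N x (p x / nu x); last by exists z.
- have [->|nz] := eqVneq (nu x) 0; first by rewrite invr0 mulr0 normr0.
  rewrite normrM normfV (ger0_norm (nu_ge0 _)) ler_pdivrMr ?mul1r//.
  by rewrite lt0r nz nu_ge0.
- have [E|nz] := eqVneq (nu x) 0; last by rewrite /= divfK.
  by rewrite /= E mulr0; apply/esym/eqP; rewrite -normr_le0 -E.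
Qed.

Lemma nu_eq0_inj x y : nu x = 0 -> nu y = 0 -> x = y.
Proof.
have pq0 z : nu z = 0 -> p z = 0 /\ q z = 0.
  move=> E; have := @nuE z; rewrite E => /(_ (ltW r0_gt0)) m0.
  by split; apply/eqP; rewrite -normr_le0 m0 le_max lexx ?orbT.
move=> Ex Ey; have [px0 qx0] := pq0 _ Ex; have [py0 qy0] := pq0 _ Ey.
by apply: box_inj; rewrite ?Ex ?Ey ?px0 ?qx0 ?py0 ?qy0// ltW.
Qed.

Lemma u_cont k : continuous (fun z => u k z).
Proof.
exact: (@continuousT_comp _ _ _ px (iter k h) px_cont
  (iter_continuous (k:=k) h_cont)).
Qed.

Lemma sim_sym k z w : sim k z w -> sim k w z.
Proof. by move=> [E ET]; split=> // j jk; rewrite ET. Qed.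

Lemma sim_trans k z1 z2 z3 : sim k z1 z2 -> sim k z2 z3 -> sim k z1 z3.
Proof.
by move=> [E ET] [F FT]; split=> [|j jk]; [rewrite E|rewrite ET ?FT].
Qed.

Lemma sim_px k z w :
  px z = px w -> (forall j, (j < k)%N -> nu (u j z) != 0) -> sim k z w.
Proof. by move=> E nz; split=> // j jk; apply: T_inj => //; exact: nz. Qed.

(** Where [nu (u k z) = 0], the slopes before [k] are determined, so [Phi] collapses that whole
    fibre to one point; compactness spreads this to a box. *)
Lemma small_radius k Phi eps : blow_down k Phi -> 0 < eps ->
  exists r, [/\ 0 < r, r <= r0,
    forall j x, (j < k)%N -> nu (iter k h x) <= r -> nu (iter j h x) != 0 &
    forall z w, nu (u k z) <= r -> nu (u k w) <= r ->
      mdist (Phi z) (Phi w) < eps].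
Proof.
move=> [cPhi _ simPhi] eps_gt0.
have [r1 r1_gt0 r1P] : exists2 r, 0 < r & forall j x, (j < k)%N ->
    nu (iter k h x) <= r -> nu (iter j h x) != 0.
  suff H m : (m <= k)%N -> exists2 r, 0 < r & forall j x, (j < m)%N ->
    nu (iter k h x) <= r -> nu (iter j h x) != 0 by exact: H.
  elim: m => [|m IH] mk; first by exists 1.
  have [r r_gt0 rP] := IH (ltnW mk).
  have [|||s s_gt0 sP] := @compact_small R M
    [set x | nu (iter m h x) != 0] (nu \o iter k h) cM.
  - exact: continuousT_comp (iter_continuous (k:=k) h_cont) nu_cont.
  - rewrite (_ : [set _ | _] = ~` [set x | nu (iter m h x) = 0]).
      rewrite openC; apply: closed_eq_continuous.
      + exact: Rhausdorff.
      + exact: continuousT_comp (iter_continuous (k:=m) h_cont) nu_cont.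
      + by move=> x; exact: cvg_cst.
    by apply/seteqP; split=> x /= /eqP.
  - move=> x /= le0; apply: nu_orbit mk _.
    by apply/eqP; rewrite eq_le le0 nu_ge0.
  exists (Num.min r s); first by rewrite lt_min r_gt0.
  move=> j x; rewrite ltnS leq_eqVlt le_min => jm /andP[xr xs].
  by case/orP: jm => [/eqP ->|jm]; [exact: sP|exact: rP].
(* Both summands are nonnegative, so the sum vanishes only on pairs from the fibre over the [k]-th
   point of the backward orbit. *)
have [||||r2 r2_gt0 r2P] := @compact_small R (X * X)%type
  [set v | mdist (Phi v.1) (Phi v.2) < eps]
  (fun v => nu (u k v.1) + nu (u k v.2)).
- by rewrite -setXTT; exact: compact_setX.
- apply: continuous_add.
    exact: (continuous_comp_fst (continuousT_comp (@u_cont k) nu_cont)).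
  exact: (continuous_comp_snd (continuousT_comp (@u_cont k) nu_cont)).
- by apply: open_lt_continuous; apply: mdist_continuous;
    [exact: continuous_comp_fst|exact: continuous_comp_snd].
- move=> [z w] /= le0; have z_ge0 := nu_ge0 (u k z).
  have w_ge0 := nu_ge0 (u k w).
  have z0 : nu (u k z) = 0 by lra.
  have w0 : nu (u k w) = 0 by lra.
  suff /simPhi -> : sim k z w by rewrite mdistxx.
  apply: sim_px => [|j jk]; last exact: nu_orbit jk z0.
  by apply: (@iter_inj k); exact: nu_eq0_inj.
exists (Num.min r0 (Num.min r1 (r2 / 2))); split.
- by rewrite !lt_min r0_gt0 r1_gt0 divr_gt0.
- by rewrite ge_min lexx.
- by move=> j x jk; rewrite !le_min => /and3P[_ xr1 _]; exact: r1P xr1.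
- move=> z w; rewrite !le_min => /and3P[_ _ zr] /and3P[_ _ wr].
  by apply: (r2P (z, w)) => /=; lra.
Qed.

(** A relation rather than a map: the target is pinned down only up to [sim k], and closedness of
    the relation stands in for continuity. *)
Definition step_inner k r z z' :=
  [/\ nu (u k z) <= r, nu (u k z') <= r, q (u k z') = q (u k z) &
    2 * p (u k z') = p (u k z) + r * T k z].

(* On the boundary [nu (u k z) = r] of the box one has [r * T k z = p (u k z)],
   hence the two alternatives agree there. *)
Definition step_rel k r z z' :=
  step_inner k r z z' \/ (r <= nu (u k z) /\ sim k z z').

Lemma step_rel_closed k r : closed [set v : X * X | step_rel k r v.1 v.2].
Proof.
have c1 := @continuous_comp_fst X X; have c2 := @continuous_comp_snd X X.
have cu (Y : topologicalType) (f : M -> Y) : continuous f ->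
    continuous (fun z => f (u k z)).
  by move=> cf; exact: continuousT_comp (@u_cont k) cf.
have cst (Y : topologicalType) (y : Y) : continuous (fun _ : X * X => y).
  by move=> v; exact: cvg_cst.
have cmul (f : X * X -> R) a : continuous f -> continuous (fun v => a * f v).
  by move=> cf; exact: continuousT_comp cf (@mulrl_continuous _ a).
have -> : [set v : X * X | step_rel k r v.1 v.2] =
  ([set v | nu (u k v.1) <= r] `&` [set v | nu (u k v.2) <= r] `&`
   [set v | q (u k v.2) = q (u k v.1)] `&`
   [set v | 2 * p (u k v.2) = p (u k v.1) + r * T k v.1]) `|`
  ([set v | r <= nu (u k v.1)] `&` [set v | px v.1 = px v.2] `&`
   \bigcap_(j in [set j | (j < k)%N]) [set v | T j v.1 = T j v.2]).
  apply/seteqP; split=> v /=; rewrite /step_rel /step_inner /sim.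
    by case=> [[]|[? []]]; [left|right].
  by case=> [[[[]]]|[[? ?] ?]]; [left|right].
apply: closedU; repeat apply: closedI.
- by apply: closed_le_continuous; [exact: (c1 _ _ (cu _ _ nu_cont))|exact: cst].
- by apply: closed_le_continuous; [exact: (c2 _ _ (cu _ _ nu_cont))|exact: cst].
- apply: closed_eq_continuous; first exact: norm_hausdorff.
    exact: (c2 _ _ (cu _ _ q_cont)).
  exact: (c1 _ _ (cu _ _ q_cont)).
- apply: closed_eq_continuous; first exact: Rhausdorff.
    exact/cmul/(c2 _ _ (cu _ _ p_cont)).
  apply: continuous_add; first exact: (c1 _ _ (cu _ _ p_cont)).
  exact: (cmul _ _ (c1 _ _ (@T_cont k))).
- by apply: closed_le_continuous; [exact: cst|exact: (c1 _ _ (cu _ _ nu_cont))].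
- by apply: closed_eq_continuous; [exact: metric_hausdorff|exact: c1|exact: c2].
- apply: closed_bigI => j _.
  by apply: closed_eq_continuous; [exact: Rhausdorff|exact: c1|exact: c2].
Qed.

(** * Blowing up one more point inside a box of radius [r] *)

Section Step.
Variables (k : nat) (r : R).
Hypotheses (r_gt0 : 0 < r) (r_le : r <= r0).
Hypothesis nu_before : forall j x, (j < k)%N ->
  nu (iter k h x) <= r -> nu (iter j h x) != 0.

Lemma step_innerP z z' : step_rel k r z z' -> nu (u k z) <= r ->
  step_inner k r z z'.
Proof.
case=> // -[rle [E _]] ler; have Er : nu (u k z) = r by lra.
split; rewrite -?E//; have := TE k z; rewrite Er => Ep.
by rewrite [r * _]mulrC Ep; ring.
Qed.

Lemma step_inner_target z z' : step_rel k r z z' -> nu (u k z') <= r ->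
  step_inner k r z z'.
Proof.
move=> G; case: (G) => [//|[_ [E _]]] ler.
by apply: step_innerP; rewrite ?E.
Qed.

Lemma step_outerP z z' : step_rel k r z z' -> r < nu (u k z) -> sim k z z'.
Proof. by move=> [[+ _ _ _]|[] //]; rewrite leNgt => /negP. Qed.

Lemma step_total z : exists z', step_rel k r z z'.
Proof.
have [le|lt] := leP (nu (u k z)) r; last first.
  by exists z; right; split=> //; exact: ltW.
have Em := nuE (le_trans le r_le).
have pr : `|p (u k z)| <= r by rewrite (le_trans _ le)// Em le_max lexx.
have qr : `|q (u k z)| <= r by rewrite (le_trans _ le)// Em le_max lexx orbT.
have pr' : `|(p (u k z) + r * T k z) / 2| <= r.
  have := T_le1 k z; move: pr; rewrite !ler_norml => /andP[? ?] /andP[? ?].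
  by apply/andP; split; nra.
have [y [yr0 py qy]] := box_surj (le_trans pr' r_le) (le_trans qr r_le).
have [x Ex] := iter_surj k y; have [z' Ez'] := px_surj x.
exists z'; left; split; rewrite ?Ez' ?Ex//.
  by rewrite nuE// py qy ge_max pr' qr.
by rewrite py; field.
Qed.

(** In the box, [p] and [q] of the target determine its base point, and by [nu_before] the base
    point determines the first [k] slopes. *)
Lemma step_functional z z1 z2 :
  step_rel k r z z1 -> step_rel k r z z2 -> sim k z1 z2.
Proof.
move=> G1 G2; have [le|lt] := leP (nu (u k z)) r; last first.
  exact: sim_trans (sim_sym (step_outerP G1 lt)) (step_outerP G2 lt).
have [_ n1 q1 p1] := step_innerP G1 le; have [_ n2 q2 p2] := step_innerP G2 le.
apply: sim_px => [|j jk]; last exact: nu_before jk n1.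
apply: (@iter_inj k); apply: box_inj.
- exact: le_trans n1 r_le.
- exact: le_trans n2 r_le.
- by lra.
- by rewrite q1 q2.
Qed.

Lemma step_onto z' : exists z, step_rel k r z z'.
Proof.
have [le|lt] := leP (nu (u k z')) r; last first.
  by exists z'; right; split => //; exact: ltW.
have Em := nuE (le_trans le r_le).
have pr : `|p (u k z')| <= r by rewrite (le_trans _ le)// Em le_max lexx.
have qr : `|q (u k z')| <= r by rewrite (le_trans _ le)// Em le_max lexx orbT.
have qr_ge0 : 0 <= `|q (u k z')| <= r by rewrite normr_ge0.
(* Solves [(a + r * t) / 2 = p (u k z')] with [m = |q|]; [fiber_surj] then realizes the slope [t],
   even over the centre. *)
have [a [t [t1 ar Et Ea]]] := slope_surj r_gt0 qr_ge0 pr.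
have [y [yr0 py qy]] := box_surj (le_trans ar r_le) (le_trans qr r_le).
have [x Ex] := iter_surj k y.
have nuy : nu y = Num.max `|a| `|q (u k z')| by rewrite nuE// py qy.
have [|z Ez ETz] := @fiber_surj k x t t1; first by rewrite Ex nuy py.
exists z; left; split; rewrite ?Ez ?Ex//; first by rewrite nuy ge_max ar qr.
by rewrite py ETz Ea.
Qed.

(** In the box, [slope_inj] recovers both [p] and [T k] from the target; outside it [nu] is nonzero,
    so [T k] is determined by the base point. *)
Lemma step_sim z w z' w' : step_rel k r z z' -> step_rel k r w w' ->
  sim k z' w' <-> sim k.+1 z w.
Proof.
move=> Gz Gw; split=> [S|[E ET]]; last first.
  have S : sim k z w by split=> // j jk; apply: ET; rewrite ltnS ltnW.
  apply: step_functional (Gz) _; case: Gw => [[? ? ? ?]|[? Sw]].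
    by left; split; rewrite ?E ?ET.
  by right; rewrite E; split => //; exact: sim_trans S Sw.
have nu_eq : nu (u k z') = nu (u k w') by case: S => ->.
have [le|lt] := leP (nu (u k z')) r; last first.
  have outer x x' : step_rel k r x x' -> r < nu (u k x') -> sim k x x'.
    by case=> [[_ + _ _]|[]//]; rewrite leNgt => /negP.
  have Sz := outer _ _ Gz lt.
  have Sw : sim k w w' by apply: outer Gw _; rewrite -nu_eq.
  have SS := sim_trans Sz (sim_trans S (sim_sym Sw)).
  case: (SS) => E ET; split=> // j; rewrite ltnS leq_eqVlt => /orP[/eqP ->|].
    apply: T_inj => //; case: Sz => -> _.
    by rewrite gt_eqF// (lt_trans r_gt0 lt).
  exact: ET.
have [nz nz' qz pz] := step_inner_target Gz le.
have [|nw nw' qw pw] := step_inner_target Gw; first by rewrite -nu_eq.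
have [E _] := S; move: qz pz; rewrite E qw pw => qz pz.
have Ez := TE k z; have Ew := TE k w; move: Ez Ew.
rewrite (nuE (le_trans nz r_le)) (nuE (le_trans nw r_le)) qz => Ez Ew.
have [Ep ETk] := slope_inj r_gt0 (T_le1 k z) (T_le1 k w) Ez Ew (esym pz).
have Epx : px z = px w.
  apply: (@iter_inj k); apply: box_inj => //.
  - exact: le_trans nz r_le.
  - exact: le_trans nw r_le.
have Sk : sim k z w by apply: sim_px => // j jk; exact: nu_before jk nz.
split=> // j; rewrite ltnS leq_eqVlt => /orP[/eqP ->//|].
by case: Sk => _; apply.
Qed.

End Step.

(** Points move only inside a box on which [Phi] varies by less than [eps]. The map [s] is a bare
    choice; [Phi \o s] is continuous because [step_rel] is closed and [Phi] is constant on [sim k]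
    classes. *)
Lemma blow_down_step k Phi eps : blow_down k Phi -> 0 < eps ->
  exists2 Phi', blow_down k.+1 Phi' & forall z, mdist (Phi z) (Phi' z) < eps.
Proof.
move=> BPhi eps_gt0; have [cPhi surjPhi simPhi] := BPhi.
have [r [r_gt0 r_le nu_before close]] := small_radius BPhi eps_gt0.
have [s sP] := choice (step_total k r_le).
exists (Phi \o s); last first.
  move=> z /=; have [le|lt] := leP (nu (u k z)) r.
    by have [? ? _ _] := step_innerP (sP z) le; exact: close.
  by have /simPhi -> := step_outerP (sP z) lt; rewrite mdistxx.
split.
- apply: (continuous_closed_rel cX (@step_rel_closed k r) cPhi) => [|z z' G].
    exact: step_total.
  by apply/simPhi; exact: (step_functional r_le nu_before G (sP z)).
- move=> y; have [z' <-] := surjPhi y.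
  have [z G] := step_onto k r_gt0 r_le z'; exists z => /=; apply/simPhi.
  exact: (step_functional r_le nu_before (sP z) G).
- move=> z w /=; rewrite simPhi.
  exact: (step_sim r_gt0 r_le nu_before (sP z) (sP w)).
Qed.

Lemma blow_down0 : blow_down 0 px.
Proof. by split=> // [y|z w]; [exact: px_surj|split=> [|[]]]. Qed.

(** * Quantitative separation of points and the limit of the stages *)

Definition sep k z w := mdist (px z) (px w) + \sum_(j < k) `|T j z - T j w|.

Lemma sep_cont k : continuous (fun v : X * X => sep k v.1 v.2).
Proof.
have c1 := @continuous_comp_fst X X; have c2 := @continuous_comp_snd X X.
apply: (@continuous_add _ _ (fun v => mdist (px v.1) (px v.2))
  (fun v => \sum_(j < k) `|T j v.1 - T j v.2|)).
  by apply: mdist_continuous; [exact: c1|exact: c2].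
elim: k => [|k IH].
  by under eq_fun do rewrite big_ord0; move=> v; exact: cvg_cst.
under eq_fun do rewrite big_ord_recr /=.
apply: (@continuous_add _ _ (fun v => \sum_(j < k) `|T j v.1 - T j v.2|)
  (fun v => `|T k v.1 - T k v.2|)) => //; apply: (@continuousT_comp _ _ _
  (fun v : X * X => T k v.1 - T k v.2) (fun x : R => `|x|)).
  move=> v.
  exact: (continuousB (c1 _ _ (@T_cont k) v) (c2 _ _ (@T_cont k) v)).
exact: norm_continuous.
Qed.

Lemma sep_nondecreasing z w :
  {homo (fun k => sep k z w) : j k / (j <= k)%N >-> j <= k}.
Proof.
apply: homo_leq => // [? ? ?|k]; first exact: le_trans.
by rewrite /sep big_ord_recr /= addrA lerDl.
Qed.

Lemma sep_sim k z w : sim k z w -> sep k z w = 0.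
Proof.
move=> [E ET]; rewrite /sep E mdistxx add0r big1// => j _.
by rewrite ET// subrr normr0.
Qed.

(** The pairs with [sep k] at least [1 / (k + 1)] form a compact set on which [Phi] identifies no
    two points. *)
Lemma blow_down_gap k Phi : blow_down k Phi ->
  exists2 d, 0 < d & forall z w, k.+1%:R^-1 <= sep k z w ->
    d < mdist (Phi z) (Phi w).
Proof.
move=> [cPhi _ simPhi].
have [|||d d_gt0 dP] := @compact_pos_lbound R (X * X)%type
  [set v | k.+1%:R^-1 <= sep k v.1 v.2] (fun v => mdist (Phi v.1) (Phi v.2)).
- apply: (@subclosed_compact _ _ [set: X * X]) => //.
    apply: closed_le_continuous; last exact: sep_cont.
    by move=> v; exact: cvg_cst.
  by rewrite -setXTT; exact: compact_setX.
- apply: mdist_continuous; first exact: continuous_comp_fst.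
  exact: continuous_comp_snd.
- move=> [z w] /= le; rewrite mdist_gt0; apply/eqP => /simPhi/sep_sim E.
  by move: le; rewrite E leNgt invr_gt0 ltr0n.
- by exists d => // z w le; exact: (dP (z, w)).
Qed.

(** [s.2] is the budget for all later displacements of a point; the factor 2 allows both points of a
    separated pair to move that far. *)
Definition good_stage k (s : (X -> M) * R) :=
  [/\ blow_down k s.1, 0 < s.2, s.2 <= k.+1%:R^-1 &
    forall z w, k.+1%:R^-1 <= sep k z w -> 2 * s.2 < mdist (s.1 z) (s.1 w)].

Lemma good_stage_ex k Phi e : blow_down k Phi -> 0 < e ->
  exists e', good_stage k (Phi, e') /\ e' <= e.
Proof.
move=> B e_gt0; have [d d_gt0 dP] := blow_down_gap B.
exists (Num.min e (Num.min k.+1%:R^-1 (d / 2))); split; last first.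
  by rewrite ge_min lexx.
split=> //=.
- by rewrite !lt_min e_gt0 invr_gt0 ltr0n divr_gt0.
- by rewrite !ge_min lexx orbT.
- move=> z w /dP; apply: le_lt_trans.
  have : Num.min e (Num.min k.+1%:R^-1 (d / 2)) <= d / 2.
    by rewrite !ge_min lexx !orbT.
  by lra.
Qed.

Lemma good_stage_step k s : good_stage k s -> exists s',
  good_stage k.+1 s' /\
  (s'.2 <= s.2 / 2 /\ forall z, mdist (s.1 z) (s'.1 z) <= s.2 / 2).
Proof.
move=> [B e_gt0 _ _]; have e2_gt0 : 0 < s.2 / 2 by rewrite divr_gt0.
have [Phi' B' close] := blow_down_step B e2_gt0.
have [e' [G le]] := good_stage_ex B' e2_gt0.
by exists (Phi', e'); split=> //; split=> // z; exact: ltW.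
Qed.

Lemma stage_sequence : exists s : nat -> (X -> M) * R, forall k,
  good_stage k (s k) /\ ((s k.+1).2 <= (s k).2 / 2 /\
    forall z, mdist ((s k).1 z) ((s k.+1).1 z) <= (s k).2 / 2).
Proof.
have [e0 [G0 _]] := good_stage_ex blow_down0 (@ltr01 R).
have /choice[F FP] : forall ks : nat * ((X -> M) * R), exists s',
    good_stage ks.1 ks.2 -> good_stage ks.1.+1 s' /\ (s'.2 <= ks.2.2 / 2 /\
    forall z, mdist (ks.2.1 z) (s'.1 z) <= ks.2.2 / 2).
  (* The last branch is a default value that makes [F] total. *)
  move=> [k s] /=; have [G|] := pselect (good_stage k s); last by exists s.
  by have [s' ?] := good_stage_step G; exists s'.
pose s := fix s k := if k is j.+1 then F (j, s j) else (px, e0).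
have G k : good_stage k (s k) by elim: k => [//|k /(FP (k, s k)) []].
by exists s => k; split=> //; have [] := FP (k, s k) (G k).
Qed.

Hypothesis px_T_inj : forall z w,
  px z = px w -> (forall j, T j z = T j w) -> z = w.

Lemma blow_down_limit :
  exists Phi : X -> M, [/\ continuous Phi, (forall y, exists z, Phi z = y) &
    injective Phi].
Proof.
have [s sP] := stage_sequence.
have G k : good_stage k (s k) by have [] := sP k.
(* Half of the budget pays for the next step, and the other half bounds the budget of the next
   stage. *)
have tail z m k : mdist ((s k).1 z) ((s (k + m)%N).1 z) <= (s k).2.
  elim: m k => [|m IH] k; first by rewrite addn0 mdistxx; have [_ /ltW] := G k.
  rewrite addnS -addSn; have [_ [le dz]] := sP k.
  have := metric_triangle ((s k).1 z) ((s k.+1).1 z) ((s (k.+1 + m)%N).1 z).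
  by have := IH k.+1; have := dz z; lra.
(* [Phi z] is a cluster point of the stages at [z], and [tail] survives the passage to it. *)
have /choice[Phi PhiP] : forall z, exists y, forall k,
    mdist ((s k).1 z) y <= (s k).2.
  move=> z; have [y [_ yP]] := @cM ((fun k => (s k).1 z) @ \oo) _ filterT.
  exists y => k; rewrite leNgt; apply/negP => lt.
  pose eta := mdist ((s k).1 z) y - (s k).2.
  have eta_gt0 : 0 < eta by rewrite subr_gt0.
  have [|y' [[m km <-] By]] :=
    yP [set (s m).1 z | m in [set m | (k <= m)%N]] _ _
      (nbhsx_ballx y eta eta_gt0).
    by exists k => // m /= km; exists m.
  move: By; rewrite ballEmdist /= metric_sym.
  have := tail z (m - k)%N k; rewrite subnKC//.
  by have := metric_triangle ((s k).1 z) ((s m).1 z) y; rewrite /eta; lra.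
have small eta : 0 < eta -> exists k, (s k).2 < eta.
  move=> eta_gt0; have [k _ kP] := near_infty_natSinv_lt (PosNum eta_gt0).
  exists k; have [_ _ le _] := G k; apply: le_lt_trans le _.
  exact: (kP k (leqnn _)).
have cPhi : continuous Phi.
  move=> z; apply/metricType_numDomainType.cvgrPdist_lt => eps eps_gt0.
  have eps3_gt0 : 0 < eps / 3 by rewrite divr_gt0.
  have [k ek] := small _ eps3_gt0; have [[ck _ _] _ _ _] := G k.
  have : \forall y \near z, mdist ((s k).1 z) ((s k).1 y) < eps / 3.
    by apply: metricType_numDomainType.cvgr_dist_lt eps3_gt0; exact: ck.
  apply: filterS => y lt; have := PhiP y k; have := PhiP z k.
  have := metric_triangle (Phi z) ((s k).1 z) (Phi y).
  have := metric_triangle ((s k).1 z) ((s k).1 y) (Phi y).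
  by rewrite (metric_sym (Phi z) ((s k).1 z)); lra.
exists Phi; split=> //.
(* The range is closed, and it is dense since every stage is onto and uniformly close to [Phi]. *)
- have cl : closed (range Phi).
    apply: compact_closed; first exact: metric_hausdorff.
    by apply: continuous_compact => //; exact: continuous_subspaceT.
  move=> y; suff /cl [z _ <-] : closure (range Phi) y by exists z.
  move=> B /nbhs_ballP [eta /= eta_gt0 etaB]; have [k ek] := small _ eta_gt0.
  have [[_ surj _] _ _ _] := G k; have [z Ez] := surj y.
  exists (Phi z); split; first by exists z.
  by apply: etaB; rewrite ballEmdist /= -Ez (le_lt_trans (PhiP z k)).
- move=> z w E; apply: contrapT => nzw.
  have [k0 sep_gt0] : exists k, 0 < sep k z w.
    apply: contrapT => /forallNP sep0; apply: nzw.
    have sep_eq0 k : mdist (px z) (px w) = 0 /\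
        \sum_(j < k) `|T j z - T j w| = 0.
      have := sep0 k; rewrite /sep => /negP; rewrite -leNgt => le0.
      have := mdist_ge0 (px z) (px w).
      have : 0 <= \sum_(j < k) `|T j z - T j w| by apply: sumr_ge0.
      by lra.
    apply: px_T_inj => [|j]; first exact: mdist_positivity (sep_eq0 0%N).1.
    have [_ /eqP] := sep_eq0 j.+1; rewrite big_ord_recr /= paddr_eq0//.
      by rewrite normr_eq0 subr_eq0 => /andP[_ /eqP].
    exact: sumr_ge0.
  have [k1 _ kP] := near_infty_natSinv_lt (PosNum sep_gt0).
  (* At this stage the images of [z] and [w] are more than [2 * (s k).2] apart, yet each is within
     [(s k).2] of the common limit. *)
  pose k := maxn k0 k1.
  have le : k.+1%:R^-1 <= sep k z w.
    apply: le_trans (ltW (kP k (leq_maxr _ _))) _ => /=.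
    exact: sep_nondecreasing (leq_maxl _ _).
  have [_ _ _ /(_ _ _ le)] := G k; have := PhiP z k; have := PhiP w k.
  have := metric_triangle ((s k).1 z) (Phi z) ((s k).1 w).
  by rewrite E (metric_sym (Phi w) ((s k).1 w)); lra.
Qed.

(** * The shift on [X]: minimality, and failure of injectivity *)

Variables (v : Q) (G : X -> X).
Hypotheses (v_norm1 : `|v| = 1) (G_cont : continuous G).
Hypothesis px_G : forall z, px (G z) = h (px z).
Hypothesis T_G : forall k z, T k (G z) = T k.+1 z.
Hypothesis h_minimal : minimal_map h.

Lemma px_iterG n z : px (iter n G z) = iter n h (px z).
Proof. by elim: n => //= n IH; rewrite px_G IH. Qed.

(** The point with coordinates [(t * s, s *: v)] has sup norm [s] and slope [t]; the unit vector [v]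
    reflects dimension at least 2. *)
Lemma direction_near (O : set M) x0 t : open O -> O x0 -> nu x0 = 0 ->
  `|t| <= 1 -> exists x, [/\ O x, nu x != 0 & p x = t * nu x].
Proof.
move=> oO Ox0 x00 t1.
have [x le0|r r_gt0 rP] := compact_small cM nu_cont oO.
  rewrite (@nu_eq0_inj x x0)//.
  by apply/eqP; rewrite eq_le le0 nu_ge0.
pose s := Num.min r r0.
have s_gt0 : 0 < s by rewrite lt_min r_gt0.
have sr0 : s <= r0 by rewrite ge_min lexx orbT.
have ts : `|t * s| <= s by rewrite normrM (gtr0_norm s_gt0) ler_piMl// ltW.
have vs : `|s *: v| = s by rewrite normrZ v_norm1 mulr1 gtr0_norm.
have [|x [xr0 px_ qx]] := box_surj (le_trans ts sr0) (b := s *: v).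
  by rewrite vs.
have nux : nu x = s by rewrite nuE// px_ qx vs max_r.
exists x; rewrite nux; split => //; last by rewrite gt_eqF.
by apply: rP; rewrite nux ge_min lexx.
Qed.

(* Over a blown-up point the fibre of [K] is full because that point can be
   approached in [M] along every direction. *)
Lemma closed_full (K : set X) : closed K ->
  (forall x, exists2 z, K z & px z = x) -> forall z, K z.
Proof.
move=> clK surjK z.
have [[k k0]|nz] := pselect (exists k, nu (u k z) = 0); last first.
  have [w Kw E] := surjK (px z); rewrite (@px_T_inj z w)// => j.
  by apply: T_inj => //; apply/eqP => j0; apply: nz; exists j.
(* By [nu_orbit] the orbit of [px z] meets the centre only at time [k], so [T k] is the only free
   slope in this fibre. *)
suff [w [Kw E ETk]] : exists w, [/\ K w, px w = px z & T k w = T k z].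
  rewrite (@px_T_inj z w)// => j; have [jk|kj|->//] := ltngtP j k.
    by apply: T_inj => //; exact: nu_orbit jk k0.
  apply: T_inj => //; apply/eqP => j0.
  by have := nu_orbit kj j0; rewrite k0 eqxx.
pose f w := mdist (px w) (px z) + `|T k w - T k z|.
have cK : compact K by apply: subclosed_compact cX _.
have f_cont : continuous f.
  have c0 (Y : topologicalType) (y : Y) : continuous (fun _ : X => y).
    by move=> w; exact: cvg_cst.
  have cT : continuous (fun w => `|T k w - T k z|).
    apply: (@continuousT_comp _ _ _ (fun w => T k w - T k z)
      (fun x : R => `|x|)); last exact: norm_continuous.
    by move=> w; exact: (continuousB (@T_cont k w) (c0 R (T k z) w)).
  exact: (continuous_add (mdist_continuous px_cont (c0 M (px z))) cT).
(* Otherwise [f] exceeds some [d > 0] on [K]; a point of [K] with slope exactly [T k z] over a base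
   point close to [px z] contradicts this. *)
apply: contrapT => /forallNP none.
have [w Kw|d d_gt0 dP] := compact_pos_lbound cK f_cont.
  have d_ge0 := mdist_ge0 (px w) (px z).
  have t_ge0 := normr_ge0 (T k w - T k z).
  rewrite lt_neqAle addr_ge0// andbT eq_sym paddr_eq0//; apply/negP.
  move=> /andP[/eqP/mdist_positivity E]; rewrite normr_eq0 subr_eq0 => /eqP ET.
  exact: (none w).
have [|||r r_gt0 rP] := @compact_small R M [set x | mdist x (px z) < d]
    (nu \o iter k h) cM.
- exact: continuousT_comp (iter_continuous (k:=k) h_cont) nu_cont.
- apply: open_lt_continuous.
  by apply: mdist_continuous => x; [exact: cvg_id|exact: cvg_cst].
- move=> x /= le0; suff -> : x = px z by rewrite mdistxx.
  apply: (@iter_inj k); apply: nu_eq0_inj k0.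
  by apply/eqP; rewrite eq_le le0 nu_ge0.
have [||y [yr y0 py]] :=
  @direction_near [set y | nu y < r] (u k z) (T k z) _ _ k0 (T_le1 k z).
- exact: open_lt_continuous.
- by rewrite /= k0.
have [x Ex] := iter_surj k y; have [w Kw Ew] := surjK x.
have ETk : T k w = T k z.
  by apply: (mulIf y0); rewrite -py -Ex -Ew TE.
have := dP _ Kw; rewrite /f ETk subrr normr0 addr0 Ew ltNge => /negP; apply.
by apply/ltW/rP; rewrite /= Ex ltW.
Qed.

(** [px] maps an orbit closure onto a closed set containing a dense [h]-orbit, hence onto [M];
    [closed_full] then fills [X]. *)
Lemma G_minimal : minimal_map G.
Proof.
move=> z W W0 oW; pose K := closure (range (fun n => iter n G z)).
suff KT w : K w.
  have [w Ww] := W0.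
  by have [y [? ?]] := KT w _ (open_nbhs_nbhs (conj oW Ww)); exists y.
move: w; apply: closed_full; first exact: closed_closure.
have clK : closed (px @` K).
  apply: compact_closed; first exact: metric_hausdorff.
  apply: continuous_compact; first exact: continuous_subspaceT.
  by apply: subclosed_compact cX _ => //; exact: closed_closure.
move=> x; suff /clK [w Kw Ew] : closure (px @` K) x by exists w.
move=> B; rewrite nbhsE => -[B' [oB' B'x] B'B].
have [|y [B'y [n _ En]]] := @h_minimal (px z) B' _ oB'; first by exists x.
exists y; split; last exact: B'B.
exists (iter n G z); last by rewrite px_iterG.
by apply: subset_closure; exists n.
Qed.

Lemma noninvertible_minimal_ex :
  exists g : M -> M, [/\ continuous g, minimal_map g & ~ homeomorphism g].
Proof.
have [Phi [cPhi surjPhi injPhi]] := blow_down_limit.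
have [Psi PsiK] := choice surjPhi.
pose g y := Phi (G (Psi y)).
have gPhi z : g (Phi z) = Phi (G z).
  by rewrite /g; congr (Phi (G _)); apply: injPhi; rewrite PsiK.
exists g; split.
(* The closed relation [Phi z = y] stands in for the continuity of [Psi]. *)
- apply: (@continuous_closed_rel M X M (fun y z => Phi z = y) (Phi \o G)) => //.
  + apply: closed_eq_continuous; first exact: metric_hausdorff.
      exact: continuous_comp_snd.
    by move=> w; exact: cvg_fst.
  + exact: continuousT_comp.
  + by move=> _ z <-; rewrite gPhi.
- move=> y O [y1 Oy1] oO.
  have [||z [Oz [n _ En]]] := @G_minimal (Psi y) (Phi @^-1` O).
  + by exists (Psi y1); rewrite /= PsiK.
  + by apply: open_comp => // z _; exact: cPhi.
  exists (Phi z); split => //; exists n => //; rewrite -En.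
  elim: n {En} => [|n IH] /=; first by rewrite PsiK.
  by rewrite IH gPhi.
- move=> [_ [g' [_ gK _]]].
  have [x0 [x0r px0 qx0]] : exists x, [/\ nu x <= r0, p x = 0 & q x = 0].
    by apply: box_surj; rewrite normr0 ltW.
  have nu0 : nu x0 = 0 by rewrite nuE// px0 qx0 !normr0 maxxx.
  have [||z Ez Tz] := @fiber_surj 0%N x0 1;
    [by rewrite normr1|by rewrite /= nu0 px0 mulr0|].
  have [||w Ew Tw] := @fiber_surj 0%N x0 (- 1);
    [by rewrite normrN1|by rewrite /= nu0 px0 mulr0|].
  (* The shift drops [T 0], the slope in which [z] and [w] differ; the later slopes agree because
     the orbit of [x0] never returns to [x0]. *)
  have EG : G z = G w.
    apply: px_T_inj => [|j]; first by rewrite !px_G Ez Ew.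
    rewrite !T_G; apply: T_inj; first by rewrite Ez.
    apply/eqP => j0; have := @nu_orbit 0%N j.+1 (px z) isT j0.
    by rewrite /= Ez nu0 eqxx.
  have /injPhi Ezw : Phi z = Phi w by apply: (can_inj gK); rewrite !gPhi EG.
  by move: Tz; rewrite Ezw Tw; lra.
Qed.

End BlowUp.

(** * Coordinates at a point of a manifold *)

Section Chart.
Context {R : realType}.

Definition row_tail m (y : 'rV[R]_m.+1) : 'rV[R]_m :=
  \row_j y ord0 (lift ord0 j).

Lemma row_norm_le m (y : 'rV[R]_m) e : 0 <= e ->
  (forall j, `|y ord0 j| <= e) -> `|y| <= e.
Proof.
move=> e_ge0 ye; rewrite [leLHS]/Num.norm /= mx_normrE; apply/bigmax_leP.
by split=> // -[i j] _; rewrite ord1; exact: ye.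
Qed.

Lemma row_entry_le m (y : 'rV[R]_m) j : `|y ord0 j| <= `|y|.
Proof.
rewrite [leRHS]/Num.norm /= mx_normrE; apply/bigmax_geP; right => /=.
by exists (ord0, j).
Qed.

Lemma row_tail_le m (y : 'rV[R]_m.+1) : `|row_tail y| <= `|y|.
Proof. by apply: row_norm_le => // j; rewrite mxE; exact: row_entry_le. Qed.

Lemma row_normE m (y : 'rV[R]_m.+1) :
  `|y| = Num.max `|y ord0 ord0| `|row_tail y|.
Proof.
apply/eqP; rewrite eq_le ge_max row_entry_le row_tail_le !andbT.
apply: row_norm_le => [|j]; first by rewrite le_max normr_ge0.
rewrite le_max; case: (unliftP ord0 j) => [i ->|->]; last by rewrite lexx.
by have := row_entry_le (row_tail y) i; rewrite mxE => ->; rewrite orbT.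
Qed.

Lemma row_tail_continuous m : continuous (@row_tail m).
Proof.
move=> y A [P Py PA].
exists (fun i j => oapp (P i) setT (unlift ord0 j)).
  move=> i j /=; case: (unliftP ord0 j) => [k ->|_] /=; last exact: filterT.
  by have := Py i k; rewrite mxE (ord1 i).
move=> z Pz; apply: PA => i j; rewrite mxE (ord1 i).
by have := Pz ord0 (lift ord0 j); rewrite liftK.
Qed.

(** [U] and the complement of [K] are open and cover [X]; [f] is continuous on each. *)
Lemma continuous_extend (X Y Z : topologicalType) (U K : set X) (c : X -> Z)
    (F : Z -> Y) (f : X -> Y) k :
  open U -> closed K -> K `<=` U -> {in U, continuous c} -> continuous F ->
  (forall x, U x -> f x = F (c x)) -> (forall x, ~ K x -> f x = k) ->
  continuous f.
Proof.
move=> oU clK KU cc cF fU fK x; have [Ux|nUx] := pselect (U x).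
  have near_fE : {near x, F \o c =1 f}.
    by apply: filterS (open_nbhs_nbhs (conj oU Ux)) => y Uy; rewrite /= fU.
  rewrite /continuous_at fU//; apply: cvg_trans (near_eq_cvg near_fE) _.
  by apply: continuous_comp; [apply: cc; exact: mem_set|exact: cF].
have nKx : ~ K x by move/KU.
rewrite /continuous_at (fK x nKx); apply: cvg_near_cst.
by apply: filterS (open_nbhs_nbhs (conj (closed_openC clK) nKx)).
Qed.

(* [p] is the first coordinate of the chart and [q] collects the others, both
   damped to [0] away from [x0]; [nu] is the sup norm of the chart cut off at
   the radius [rho]. *)
Lemma box_chart m (M : topologicalType) (x0 : M) :
  hausdorff_space M -> locally_euclidean R m.+1 M ->
  exists (nu p : M -> R) (q : M -> 'rV[R]_m) (r0 : R),
    [/\ continuous nu, continuous p, continuous q, 0 < r0 &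
    [/\ forall x, nu x <= r0 -> nu x = Num.max `|p x| `|q x|,
      forall a b, `|a| <= r0 -> `|b| <= r0 ->
        exists x, [/\ nu x <= r0, p x = a & q x = b],
      forall x y, nu x <= r0 -> nu y <= r0 -> p x = p y -> q x = q y -> x = y,
      forall x, `|p x| <= nu x & nu x0 = 0]].
Proof.
move=> hM /(_ x0)[U [V [phi [psi [oU Ux0 oV]]]]].
move=> [phiU psiV phiK psiK [cphi cpsi]].
pose y0 := phi x0; have Vy0 : V y0 by exact: phiU.
have [d /= d_gt0 dV] : exists2 d : R, 0 < d & ball y0 d `<=` V.
  by apply/nbhs_ballP; exact: open_nbhs_nbhs.
pose rho := d / 2; have rho_gt0 : 0 < rho by rewrite divr_gt0.
have rhoV y : `|y| <= rho -> V (y + y0).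
  move=> le; apply: dV; rewrite -ball_normE /= opprD addrCA subrr addr0 normrN.
  by apply: le_lt_trans le _; rewrite /rho; lra.
pose c x := phi x - y0.
(* A plateau: [1] up to [rho / 2], [0] from [rho] on, linear in between. *)
pose chi (s : R) := Num.min 1 (Num.max 0 (2 - 2 / rho * s)).
have chi_le1 s : 0 <= chi s <= 1.
  by rewrite /chi ge_min lexx le_min ler01 le_max lexx.
have chi1 s : s <= rho / 2 -> chi s = 1.
  move=> le; have : 2 / rho * s <= 1.
    by rewrite mulrAC ler_pdivrMr//; lra.
  by move=> le1; rewrite /chi max_r ?min_l//; lra.
have chi0 s : rho <= s -> chi s = 0.
  move=> le; have : 2 <= 2 / rho * s.
    by rewrite mulrAC ler_pdivlMr//; lra.
  by move=> le2; rewrite /chi max_l ?min_r//; lra.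
pose F (y : 'rV[R]_m.+1) := chi `|y| *: y.
pose E x := if x \in U then F (c x) else 0.
pose nu x := if x \in U then Num.min `|c x| rho else rho.
(* The closed ball in the chart: compact, hence closed in [M], and off it [E] and [nu] are
   constant. *)
pose K := psi @` [set y | `|y0 - y| <= rho].
have clK : closed K.
  apply: compact_closed hM _; apply: continuous_compact.
    apply: continuous_subspaceW cpsi => y; rewrite /= distrC => /rhoV.
    by rewrite subrK.
  apply: bounded_closed_compact.
    exists (`|y0| + rho); split; first exact: num_real.
    move=> s lt y /=; rewrite distrC => le; apply: ltW; apply: le_lt_trans lt.
    by rewrite -[y](subrK y0) (le_trans (ler_normD _ _))// addrC lerD2l.
  exact: closed_closed_ball_.
have KU : K `<=` U.
  move=> _ [y /= le <-]; move: le; rewrite distrC => le; apply: psiV.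
  by rewrite -(subrK y0 y); exact: rhoV.
have nK x : U x -> ~ K x -> rho < `|c x|.
  move=> Ux nKx; rewrite ltNge; apply/negP => le; apply: nKx.
  by exists (phi x); rewrite /= ?phiK// distrC.
have cc : {in U, continuous c}.
  have : {in U, continuous phi} by rewrite -continuous_open_subspace.
  move=> cphi' x Ux; apply: continuousB; [exact: cphi'|exact: cvg_cst].
have min_cont (X : topologicalType) (f g : X -> R) : continuous f ->
    continuous g -> continuous (fun x => Num.min (f x) (g x)).
  by move=> cf cg x; apply: (@continuous_min _ _ f g); [exact: cf|exact: cg].
have max_cont (X : topologicalType) (f g : X -> R) : continuous f ->
    continuous g -> continuous (fun x => Num.max (f x) (g x)).
  by move=> cf cg x; apply: (@continuous_max _ _ f g); [exact: cf|exact: cg].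
have cst_cont (X Y : topologicalType) (y : Y) : continuous (fun _ : X => y).
  by move=> x; exact: cvg_cst.
have norm_cont : continuous (fun y : 'rV[R]_m.+1 => `|y|).
  exact: norm_continuous.
have chi_cont : continuous chi.
  apply: min_cont; first exact: cst_cont.
  apply: max_cont; first exact: cst_cont.
  apply: continuous_add; first exact: cst_cont.
  by under eq_fun do rewrite -mulNr; exact: mulrl_continuous.
have F_cont : continuous F.
  have cn := continuousT_comp norm_cont chi_cont.
  move=> y; apply: (@continuousZ R 'rV[R]_m.+1 'rV[R]_m.+1
    (chi \o Num.norm) id y); first exact: cn.
  by move=> A.
have E_cont : continuous E.
  apply: (@continuous_extend _ _ _ U K c F _ 0) => // x.
    by move=> Ux; rewrite /E mem_set.
  move=> nKx; rewrite /E; case: ifPn => // /set_mem Ux.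
  by rewrite /F chi0 ?scale0r// ltW// nK.
have nu_cont : continuous nu.
  apply: (@continuous_extend _ _ _ U K c
    (fun y => Num.min `|y| rho) _ rho) => //.
  - by apply: min_cont => //; exact: cst_cont.
  - by move=> x Ux; rewrite /nu mem_set.
  - move=> x nKx; rewrite /nu; case: ifPn => // /set_mem Ux.
    by rewrite min_r// ltW// nK.
(* Up to radius [rho / 2] neither cutoff acts; this is why [r0] is [rho / 2]. *)
have inner x : nu x <= rho / 2 -> [/\ U x, nu x = `|c x| & E x = c x].
  rewrite /nu /E; case: ifPn => [/set_mem Ux|_ le]; last by lra.
  rewrite ge_min => /orP[le|le]; last by lra.
  by rewrite min_l /F ?chi1 ?scale1r//; lra.
have c_inj x y : U x -> U y -> c x = c y -> x = y.
  by move=> Ux Uy /addIr e; rewrite -(phiK x)// -(phiK y)// e.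
exists nu, (fun x => E x ord0 ord0), (fun x => row_tail (E x)), (rho / 2).
split=> //.
- exact: continuousT_comp E_cont (@coord_continuous _ _ _ _ _).
- exact: continuousT_comp E_cont (@row_tail_continuous m).
- by rewrite divr_gt0.
split.
- by move=> x /inner[_ -> ->]; exact: row_normE.
- move=> a b ar br.
  pose y : 'rV[R]_m.+1 := \row_i oapp (b ord0) a (unlift ord0 i).
  have ya : y ord0 ord0 = a by rewrite mxE unlift_none.
  have yb : row_tail y = b by apply/rowP => j; rewrite !mxE liftK.
  have yr : `|y| <= rho / 2 by rewrite row_normE ya yb ge_max ar br.
  have Vy : V (y + y0) by apply: rhoV; lra.
  have Ux : U (psi (y + y0)) by exact: psiV.
  have cx : c (psi (y + y0)) = y by rewrite /c psiK// addrK.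
  have nux : nu (psi (y + y0)) <= rho / 2 by rewrite /nu mem_set// cx ge_min yr.
  have [_ _ Ex] := inner _ nux.
  by exists (psi (y + y0)); rewrite Ex cx.
- move=> x y /inner[Ux _ ->] /inner[Uy _ ->] E0 Et; apply: c_inj => //.
  apply/rowP => j; case: (unliftP ord0 j) => [i ->|-> //].
  by move/rowP: Et => /(_ i); rewrite !mxE.
- move=> x; apply: le_trans (row_entry_le _ _) _; rewrite /E /nu.
  case: ifPn => _; last by rewrite normr0 ltW.
  have /andP[c0 c1] := chi_le1 `|c x|.
  rewrite /F normrZ (ger0_norm c0) le_min ler_piMl//=.
  have [le|lt] := leP `|c x| rho; first exact: le_trans (ler_piMl _ c1) le.
  by rewrite chi0 ?mul0r ?ltW.
- by rewrite /nu mem_set// /c subrr normr0 min_l// ltW.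
Qed.

End Chart.

(** * The blown-up space *)

Section BlowUpSpace.
Context {R : realType}.

Lemma compact_set_type (X : topologicalType) (A : set X) :
  compact A -> compact [set: A].
Proof.
move=> cA F PF _.
have FA : (set_val @ F) A.
  by apply: (@filterS _ F _ setT) => [z _|]; [exact: set_valP|exact: filterT].
have [x [Ax clx]] := cA _ _ FA.
exists (exist _ x (mem_set Ax)); split=> // P B FP.
rewrite nbhsE => -[_ [[W oW <-] /= Wx] WB].
have FP' : (set_val @ F) (set_val @` P).
  by apply: (@filterS _ F _ P) => // z Pz; exists z.
have [_ [[z Pz <-] Wz]] := clx _ _ FP' (open_nbhs_nbhs (conj oW Wx)).
by exists z; split => //; exact: WB.
Qed.

Lemma continuous_to_prod (X : topologicalType) (I : Type)
    (Y : I -> topologicalType) (f : X -> prod_topology Y) :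
  (forall i, continuous (fun x => f x i)) -> continuous f.
Proof.
move=> cf x; apply/cvg_sup => i.
exact: (@continuous_comp_initial (forall i, Y i) X (Y i) (@^~ i) f (cf i)).
Qed.

Lemma dense_closed_setT (X : topologicalType) (A : set X) :
  dense A -> closed A -> A = setT.
Proof.
move=> dA cA; apply/seteqP; split=> // x _; apply: contrapT => nAx.
by have [|y []] := dA (~` A) _ (closed_openC cA); first by exists x.
Qed.

Lemma iter_periodic_finite (X : Type) (f : X -> X) d x :
  (0 < d)%N -> iter d f x = x -> finite_set (range (fun n => iter n f x)).
Proof.
move=> d_gt0 fx; apply: (@sub_finite_set _ _ ((fun n => iter n f x) @` `I_d)).
  move=> _ [n _ <-]; exists (n %% d)%N; first exact: ltn_pmod.
  by rewrite [in RHS](divn_eq n d) addnC iterD iterM (iter_fix _ fx).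
exact/finite_image/finite_II.
Qed.

Variables (M : metricType R) (h : M -> M) (nu p : M -> R).

(* The closure in [M * R^nat] of the graph of [x |-> (p / nu) (h^k x)], which is
   defined off the backward orbit of the zero of [nu]. *)
Definition blow_up : set (M * prod_topology (fun _ : nat => R)) :=
  [set w | forall k, `|w.2 k| <= 1 /\
    w.2 k * nu (iter k h w.1) = p (iter k h w.1)].

Definition base (z : blow_up) : M := (set_val z).1.
Definition slope (k : nat) (z : blow_up) : R := (set_val z).2 k.

Lemma base_continuous : continuous base.
Proof.
apply: (@continuousT_comp _ _ _ set_val fst); first exact: initial_continuous.
by move=> w; exact: cvg_fst.
Qed.

Lemma snd_coord_continuous k :
  continuous (fun w : M * prod_topology (fun _ : nat => R) => w.2 k).
Proof.
apply: (@continuous_comp_snd M (prod_topology (fun _ : nat => R)) R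
  (fun f => f k)).
exact: (@proj_continuous nat (fun _ => R) k).
Qed.

Lemma slope_continuous k : continuous (slope k).
Proof.
apply: (@continuousT_comp blow_up (M * prod_topology (fun _ : nat => R))%type R
  set_val (fun w => w.2 k)); first exact: initial_continuous.
exact: snd_coord_continuous.
Qed.

Lemma slope_le1 k z : `|slope k z| <= 1.
Proof. by have [] := set_valP z k. Qed.

Lemma slopeE k z : slope k z * nu (iter k h (base z)) = p (iter k h (base z)).
Proof. by have [] := set_valP z k. Qed.

Lemma base_slope_inj z w :
  base z = base w -> (forall k, slope k z = slope k w) -> z = w.
Proof.
move=> E Es; apply: val_inj; rewrite [LHS]surjective_pairing.
rewrite [RHS]surjective_pairing; congr pair; first exact: E.
by apply/funext => k; exact: Es.
Qed.

Lemma shift_subproof (z : blow_up) :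
  (h (base z), fun k => slope k.+1 z) \in blow_up.
Proof.
apply/mem_set => k /=; split; first exact: slope_le1.
by rewrite -iterSr; exact: slopeE.
Qed.

Definition shift (z : blow_up) : blow_up :=
  exist _ (h (base z), fun k => slope k.+1 z) (shift_subproof z).

Lemma shift_continuous : continuous h -> continuous shift.
Proof.
move=> ch; apply: continuous_comp_initial.
pose tail (z : blow_up) : prod_topology (fun _ : nat => R) :=
  fun k => slope k.+1 z.
have ctail : continuous tail.
  by apply: continuous_to_prod => k; exact: slope_continuous.
have cbase : continuous (h \o base).
  exact: continuousT_comp base_continuous ch.
have cpair : continuous (fun z => (h (base z), tail z)).
  move=> z; exact: (@cvg_pair _ _ _ (nbhs z) (nbhs (h (base z)))
    (nbhs (tail z)) _ _ _ _ _ (cbase z) (ctail z)).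
exact: cpair.
Qed.

Lemma blow_up_fiber k x t : (forall y, `|p y| <= nu y) -> `|t| <= 1 ->
  t * nu (iter k h x) = p (iter k h x) ->
  exists2 z, base z = x & slope k z = t.
Proof.
move=> p_le t1 tE.
(* At a zero of [nu] the quotient is [0] by the convention for division by zero, an admissible slope
   since [p] vanishes there too. *)
pose s j := if j == k then t else p (iter j h x) / nu (iter j h x).
have sP : (x, s) \in blow_up.
  apply/mem_set => j /=; rewrite /s; case: eqP => [->//|_].
  set y := iter j h x; have nu_ge0 := le_trans (normr_ge0 _) (p_le y).
  have [nu0|nz] := eqVneq (nu y) 0; last first.
    rewrite divfK//; split=> //.
    by rewrite normrM normfV (ger0_norm nu_ge0) ler_pdivrMr ?mul1r// lt0r nz.
  rewrite nu0 invr0 !mulr0 normr0; split=> //.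
  by apply/esym/eqP; rewrite -normr_le0 -nu0.
by exists (exist _ (x, s) sP) => //; rewrite /slope /= /s eqxx.
Qed.

(** A closed subset of the product of [M] with a countable power of [[-1, 1]], compact by
    Tychonoff. *)
Lemma blow_up_compact : compact [set: M] -> continuous h -> continuous nu ->
  continuous p -> compact [set: blow_up].
Proof.
move=> cM ch cnu cp; apply: compact_set_type.
have cbox : compact [set f : prod_topology (fun _ : nat => R) |
    forall k, `[-1, 1]%classic (f k)].
  apply: (@tychonoff nat (fun _ => R) (fun _ => `[-1, 1]%classic)) => k.
  exact: segment_compact.
apply: (subclosed_compact _ (compact_setX cM cbox)); last first.
  move=> w wP; split=> // k; rewrite /= in_itv /= -ler_norml.
  by have [] := wP k.
have -> : blow_up = \bigcap_(k in [set: nat]) ([set w | `|w.2 k| <= 1] `&`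
    [set w | w.2 k * nu (iter k h w.1) = p (iter k h w.1)]).
  by apply/seteqP; split=> w wP; [move=> k _; exact: wP|move=> k; exact: wP].
have cst_cont (X Y : topologicalType) (y : Y) : continuous (fun _ : X => y).
  by move=> x; exact: cvg_cst.
have citer k (f : M -> R) : continuous f ->
    continuous (fun w : M * prod_topology (fun _ : nat => R) =>
      f (iter k h w.1)).
  move=> cf; apply: (@continuous_comp_fst _ _ _ (f \o iter k h)).
  exact: continuousT_comp (iter_continuous (k:=k) ch) cf.
apply: closed_bigI => k _; apply: closedI.
  apply: closed_le_continuous; last exact: cst_cont.
  exact: continuousT_comp (@snd_coord_continuous k) (@norm_continuous _ R).
apply: closed_eq_continuous; [exact: Rhausdorff| |exact: citer].
by move=> w; exact: (continuousM (@snd_coord_continuous k w) (citer k _ cnu w)).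
Qed.

End BlowUpSpace.

Theorem theorem3p1 (R : realType) (n : nat) (M : metricType R)
    (hn : (2 <= n)%N)
    (hM : is_manifold R n M)
    (hcompact : compact [set: M])
    (hnonempty : [set: M] !=set0)
    (hmin : exists h : M -> M, homeomorphism h /\ minimal_map h) :
  exists g : M -> M,
    [/\ continuous g, minimal_map g & ~ homeomorphism g].
Proof.
have [hausM _ euclM] := hM; have [x0 _] := hnonempty.
have [h [[h_cont [h' [_ hK h'K]]] h_min]] := hmin.
have h_bij : bijective h by exists h'.
case: n hn euclM {hM} => [//|[//|m]] _ /(box_chart x0 hausM).
move=> [nu [p [q [r0 [nu_cont p_cont q_cont r0_gt0]]]]].
move=> [nuE box_surj box_inj p_le nu_x0].
(* As the dimension is [m.+2], the rows of remaining coordinates are nonempty and contain a unit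
   vector. *)
pose v : 'rV[R]_m.+1 := const_mx 1.
have v_norm1 : `|v| = 1.
  apply/eqP; rewrite eq_le row_norm_le ?ler01//=.
    by have := row_entry_le v ord0; rewrite mxE normr1.
  by move=> j; rewrite mxE normr1.
have nu_orbit j k x : (j < k)%N ->
    nu (iter k h x) = 0 -> nu (iter j h x) != 0.
  (* A second visit to [x0] makes it periodic. Its dense orbit is then finite, so [M] is finite and
     [x0] isolated, against [direction_near]. *)
  move=> jk nu_k; apply/eqP => nu_j.
  have x0E := nu_eq0_inj r0_gt0 nuE box_inj nu_x0.
  have periodic : iter (k - j) h x0 = x0.
    by rewrite [in LHS](x0E _ nu_j) -iterD subnK 1?ltnW// (x0E _ nu_k).
  have kj_gt0 : (0 < k - j)%N by rewrite subn_gt0.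
  have finite_orbit := iter_periodic_finite kj_gt0 periodic.
  have finite_closed (A : set M) : finite_set A -> closed A.
    by apply: (iffLR accessible_finite_set_closed); exact: hausdorff_accessible.
  have finM : finite_set [set: M].
    rewrite -(dense_closed_setT (h_min x0)) //; exact: finite_closed.
  have open_x0 : open [set x0].
    rewrite -[X in open X]setCK openC; apply: finite_closed.
    exact: sub_finite_set finM.
  have [|y [-> + _]] := direction_near hcompact nu_cont r0_gt0 nuE box_surj
    box_inj p_le v_norm1 open_x0 (erefl x0) nu_x0 (t := 0).
    by rewrite normr0.
  by rewrite nu_x0 eqxx.
apply: (@noninvertible_minimal_ex R M _ _ h nu p q r0 (@base R M h nu p)
  (@slope R M h nu p) _ hcompact h_cont h_bij nu_cont p_cont q_cont _ _
  r0_gt0 nuE box_surj box_inj p_le nu_orbit _ _ _ _ v (@shift R M h nu p)).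
- exact: blow_up_compact.
- exact: base_continuous.
- exact: slope_continuous.
- exact: slope_le1.
- exact: slopeE.
- by move=> k x t; exact: blow_up_fiber.
- exact: base_slope_inj.
- exact: v_norm1.
- exact: shift_continuous.
- by [].
- by [].
- exact: h_min.
Qed.
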